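(* Let $m\ge 1$ and let $0\le a_1<a_2<\cdots<a_m$ be fixed integers. There exists a real number $\lambda_{a_1,\dots,a_m}$ such that $$\mathbb{P}\left(k+a_1,\ k+a_2,\ \dots,\ \text{and}\ k+a_m\notin A+A\right)\ =\ \Theta\left(\lambda_{a_1,\dots,a_m}^{\,k}\right),$$ that is, there are constants $C_1,C_2>0$, depending on $a_1,\dots,a_m$ but not on $k$, such that for all integers $k\ge 0$ the probability on the left lies between $C_1\lambda_{a_1,\dots,a_m}^{\,k}$ and $C_2\lambda_{a_1,\dots,a_m}^{\,k}$.
   Context: For integers $a\le b$, $[a,b]$ denotes the set of integers $x$ with $a\le x\le b$. For a set $X$ of integers, $X+X=\{x+y: x,y\in X\}$. $A$ is chosen uniformly at random among the subsets of $[0,n-1]$, where $n>k+a_m$; the probability that all of $k+a_1,\dots,k+a_m$ lie outside $A+A$ depends only on $A\cap[0,k+a_m]$, so it does not depend on the choice of such $n$ (one may take $A\subseteq[0,k+a_m]$). *)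

(* Defs.v *)
From HB Require Import structures.
From mathcomp Require Import all_boot all_order all_algebra.
From mathcomp Require Import reals.

Set Implicit Arguments.
Unset Strict Implicit.
Unset Printing Implicit Defensive.

Import Order.TTheory GRing.Theory Num.Theory.
Local Open Scope ring_scope.

(* A + A for A a subset of [0, n - 1].  The sums are natural numbers, not
   taken modulo n. *)
Definition sumset (n : nat) (A : {set 'I_n}) : pred nat :=
  [pred s : nat | [exists x in A, [exists y in A, s == (x + y)%N]]].

Definition uniform_prob (R : realType) (T : finType) (E : {set T}) : R :=
  #|E|%:R / #|T|%:R.

Definition missing (n k : nat) (a : seq nat) : {set {set 'I_n}} :=
  [set A : {set 'I_n} | all (fun ai => (k + ai)%N \notin sumset A) a].

(* Main.v *)
Require Import Defs.
From HB Require Import structures.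
From mathcomp Require Import classical_sets exp.
From mathcomp Require Import all_boot all_order all_algebra.
From mathcomp Require Import reals.
From mathcomp Require Import zify.

Import Order.TTheory GRing.Theory Num.Theory.
Local Open Scope ring_scope.

(** Write P_k for the probability that k + s lies outside A + A for every s in
    a, and D for the largest entry of a.

    Fold the integers about k / 2: for x, y < k / 2, place x on one side of a
    strip and k - y on the other, at height y.  The pair x, k - y is forbidden
    exactly when x - y is an entry of a, so the forbidden pairs form a
    translation-invariant bipartite graph of range D which no longer depends
    on k.  Up to a bounded number of integers (those next to the fold, and
    those in [k + 1, k + D]), A avoids k + a in its sumset iff its folded image
    is an independent set of the strip of length L = k / 2.  Let f L be the
    probability that a uniform subset of the strip of length L is independent.

    Restricting a random set to part of the vertices gives a uniform set, so
    dropping constraints bounds a probability from above, while emptying c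
    vertices to meet the extra constraints costs a factor at most 2 ^ c.
    These two comparisons, [uniform_prob_le_preimset] and
    [uniform_prob_preimset_erase], yield everything combinatorial:
    - f (L + M) <= f L * f M <= 2 ^ D * f (L + M), by cutting the strip
      ([strip_submul], [strip_supermul]);
    - P_k <= f (k / 2) <= 2 ^ (2 D + 1) * P_k, by folding
      ([missing_le_strip], [strip_le_missing]).

    Being multiplicative up to a constant forces f L to lie between constant
    multiples of mu ^ L for some mu > 0: this is a two-sided form of Fekete's
    lemma, [quasi_multiplicative_geometric].  Hence P_k has order
    mu ^ (k / 2), and lambda is the square root of mu. *)

(** * Uniform random subsets of a finite type *)

Section UniformSubsets.
Set Implicit Arguments.
Unset Strict Implicit.
Context {R : realType}.
Implicit Types T U : finType.

Lemma uniform_prob_le T (E F : {set T}) :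
  E \subset F -> uniform_prob R E <= uniform_prob R F.
Proof.
by move=> sEF; rewrite ler_wpM2r ?invr_ge0 ?ler0n// ler_nat subset_leq_card.
Qed.

Lemma uniform_prob_gt0 T (E : {set T}) (x : T) : x \in E -> 0 < uniform_prob R E.
Proof.
move=> xE; rewrite divr_gt0 ?ltr0n//; apply/card_gt0P; first by exists x.
by exists x.
Qed.

(** The trace of a uniform subset on an embedded copy of T is uniform: a subset
    of U amounts to its trace together with an arbitrary set outside the
    copy. *)
Lemma uniform_prob_preimset T U (h : T -> U) (F : {set {set T}}) :
  injective h ->
  uniform_prob R [set A : {set U} | h @^-1: A \in F] = uniform_prob R F.
Proof.
move=> h_inj; set G := [set A | _].
pose I := [set h x | x in [set: T]].
have hI x : h x \in I by rewrite imset_f ?inE.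
have split_inj : injective (fun A : {set U} => (h @^-1: A, A :\: I)).
  move=> A B [/setP eq_pre /setP eq_out]; apply/setP => u.
  have [/imsetP[x _ ->]|uNI] := boolP (u \in I).
    by have := eq_pre x; rewrite !inE.
  by have := eq_out u; rewrite !inE uNI.
have GE : (fun A : {set U} => (h @^-1: A, A :\: I)) @: G = setX F (powerset (~: I)).
  apply/setP => -[B C]; rewrite in_setX powersetE; apply/imsetP/andP.
    case=> A; rewrite inE => AG [-> ->]; split=> //.
    by apply/subsetP => u; rewrite !inE => /andP[].
  case=> BF /subsetP CI.
  have preE : h @^-1: (h @: B :|: C) = B.
    apply/setP => x; rewrite !inE mem_imset//; case: (boolP (h x \in C)).
      by move/CI; rewrite inE hI.
    by rewrite orbF.
  exists (h @: B :|: C); first by rewrite inE preE.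
  rewrite preE; congr pair; apply/setP => u; rewrite !inE.
  have [/imsetP[x _ ->]|uNI] /= := boolP (u \in I).
    by apply/negbTE/negP => /CI; rewrite inE hI.
  by case: imsetP => // -[x _ ux]; rewrite ux hI in uNI.
have cardG : #|G| = (#|F| * 2 ^ #|~: I|)%N.
  by rewrite -(card_imset _ split_inj) GE cardsX card_powerset.
have cardU : (2 ^ #|U| = 2 ^ #|T| * 2 ^ #|~: I|)%N.
  by rewrite -expnD -(cardsC I) card_imset// cardsT.
rewrite /uniform_prob cardG -!cardsT -!powersetT !card_powerset !cardsT cardU.
by rewrite !natrM -mulf_div divff ?mulr1// pnatr_eq0 expn_eq0.
Qed.

(** Upper comparison: forgetting the constraints that involve points outside
    the image of h can only increase the probability. *)
Lemma uniform_prob_le_preimset T U (h : T -> U)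
    (E : {set {set U}}) (F : {set {set T}}) :
  injective h -> (forall A, A \in E -> h @^-1: A \in F) ->
  uniform_prob R E <= uniform_prob R F.
Proof.
move=> h_inj EF; rewrite -(uniform_prob_preimset F h_inj).
by apply: uniform_prob_le; apply/subsetP => A AE; rewrite inE EF.
Qed.

(** A set is determined by what remains after erasing Z and by its trace on Z,
    so erasing Z is at most 2 ^ #|Z| to one. *)
Lemma uniform_prob_erase T (Z : {set T}) (E G : {set {set T}}) :
  (forall A, A \in G -> A :\: Z \in E) ->
  uniform_prob R G <= 2 ^+ #|Z| * uniform_prob R E.
Proof.
move=> GE; rewrite /uniform_prob mulrA ler_wpM2r ?invr_ge0 ?ler0n//.
rewrite -natrX -natrM ler_nat mulnC -card_powerset -cardsX.
have split_inj : injective (fun A : {set T} => (A :\: Z, A :&: Z)).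
  by move=> A B [AB1 AB2]; rewrite -(setID A Z) AB1 AB2 setID.
rewrite -(card_imset _ split_inj); apply/subset_leq_card/subsetP => p.
by case/imsetP => A /GE AE ->; rewrite in_setX AE powersetE subsetIr.
Qed.

(** Lower comparison: if the constraints on U that are not carried by T can be
    satisfied by emptying Z, they cost at most a factor 2 ^ #|Z|. *)
Lemma uniform_prob_preimset_erase T U (h : T -> U) (Z : {set U}) (c : nat)
    (E : {set {set U}}) (F : {set {set T}}) :
  injective h -> (#|Z| <= c)%N ->
  (forall A : {set U}, h @^-1: A \in F -> A :\: Z \in E) ->
  uniform_prob R F <= 2 ^+ c * uniform_prob R E.
Proof.
move=> h_inj Zc FE; rewrite -(uniform_prob_preimset F h_inj).
apply: le_trans (uniform_prob_erase (E := E) (Z := Z) _) _.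
  by move=> A; rewrite inE; apply: FE.
by rewrite ler_wpM2r ?divr_ge0 ?ler0n// ler_weXn2l// (ler_nat _ 1 2).
Qed.

Definition sum_event T U (E : {set {set T}}) (F : {set {set U}}) :
    {set {set T + U}} :=
  [set A : {set T + U} | (inl @^-1: A \in E) && (inr @^-1: A \in F)].

(** The traces of a uniform subset on two disjoint parts are independent. *)
Lemma uniform_prob_sum_event T U (E : {set {set T}}) (F : {set {set U}}) :
  uniform_prob R (sum_event E F) = uniform_prob R E * uniform_prob R F.
Proof.
pose split (A : {set T + U}) := (inl @^-1: A : {set T}, inr @^-1: A : {set U}).
have split_inj : injective split.
  move=> A B [/setP eql /setP eqr]; apply/setP => -[x|x].
    by have := eql x; rewrite !inE.
  by have := eqr x; rewrite !inE.
have splitE : split @: sum_event E F = setX E F.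
  apply/setP => -[B C]; rewrite in_setX; apply/imsetP/idP.
    by case=> A; rewrite inE => AEF [-> ->].
  move=> /andP BC.
  pose A := [set z : T + U | match z with inl x => x \in B | inr y => y \in C end].
  have splitA : split A = (B, C) by congr pair; apply/setP => x; rewrite !inE.
  by exists A; rewrite ?splitA// inE; case: splitA => -> ->; apply/andP.
rewrite /uniform_prob -(card_imset _ split_inj) splitE cardsX.
rewrite -!cardsT -!powersetT !card_powerset !cardsT card_sum expnD !natrM.
by rewrite mulf_div.
Qed.

End UniformSubsets.

(** * Sequences that are multiplicative up to a constant *)

(** The sequence g = f / C is supermultiplicative, f is submultiplicative and
    g <= f, whence g i ^ j <= g (i j) <= f (i j) <= f j ^ i.  So every i-th
    root of g i is at most every j-th root of f j, and mu can be any number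
    separating the two families; the supremum of the first one serves. *)
Lemma quasi_multiplicative_geometric (R : realType) (f : nat -> R) (C : R) :
  (forall i, 0 < f i) ->
  (forall i j, f (i + j)%N <= f i * f j) ->
  (forall i j, f i * f j <= C * f (i + j)%N) ->
  exists2 mu, 0 < mu & forall i, mu ^+ i <= f i <= C * mu ^+ i.
Proof.
move=> f_gt0 f_sub f_super.
have f0_ge1 : 1 <= f 0%N.
  by have := f_sub 0%N 0%N; rewrite -{1}[f _]mulr1 ler_pM2l.
have f0_leC : f 0%N <= C by have := f_super 0%N 0%N; rewrite addn0 ler_pM2r.
have C_gt0 : 0 < C by exact: lt_le_trans f0_leC.
pose g i := f i / C.
have g_gt0 i : 0 < g i by rewrite divr_gt0.
have f_pow i j : (0 < j)%N -> f (i * j)%N <= f i ^+ j.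
  case: j => // j _; elim: j => [|j IH]; first by rewrite muln1 expr1.
  rewrite mulnS exprS; apply: le_trans (f_sub _ _) _.
  by rewrite ler_pM2l.
have g_super i j : g i * g j <= g (i + j)%N.
  rewrite /g mulf_div ler_pdivrMr ?mulr_gt0// mulrA divfK ?gt_eqF//.
  by rewrite [f _ * C]mulrC f_super.
have g_pow i j : (0 < j)%N -> g i ^+ j <= g (i * j)%N.
  case: j => // j _; elim: j => [|j IH]; first by rewrite muln1 expr1.
  rewrite mulnS exprS; apply: le_trans (g_super _ _).
  by rewrite ler_pM2l.
have gf i : g i <= f i.
  by rewrite ler_pdivrMr// ler_peMr// ?(le_trans f0_ge1)// ltW.
(* The numbers below some root of g, phrased with powers. *)
pose S : set R :=
  [set t | 0 <= t /\ exists2 i, (0 < i)%N & t ^+ i <= g i]%classic.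
have S_ub j s : (0 < j)%N -> S s -> s ^+ j <= f j.
  move=> j0 [s0 [i i0 si]].
  rewrite -(ler_pXn2r i0) ?nnegrE ?exprn_ge0 ?(ltW (f_gt0 _))//.
  rewrite -exprM mulnC exprM; apply: (@le_trans _ _ (g i ^+ j)).
    by rewrite lerXn2r ?nnegrE ?exprn_ge0// ltW.
  apply: le_trans (g_pow _ _ j0) _; apply: le_trans (gf _) _.
  by rewrite mulnC f_pow.
have S_g1 : S (g 1%N) by split; [exact: ltW | exists 1%N].
have S_sup : has_sup S.
  by split; [exists (g 1%N) | exists (f 1%N) => s /(S_ub 1%N s isT)].
have supP s : S s -> s <= sup S by move=> Ss; apply: ub_le_sup => //; case: S_sup.
have root i (x : R) : (0 < i)%N -> 0 < x -> (x `^ i%:R^-1) ^+ i = x.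
  move=> i0 x0; rewrite -powR_mulrn ?powR_ge0// -powRrM mulVf ?powRr1 ?ltW//.
  by rewrite pnatr_eq0 -lt0n.
have sup_gt0 : 0 < sup S by exact: lt_le_trans (g_gt0 1%N) (supP _ S_g1).
exists (sup S) => // i; have [->|i0] := posnP i; first by rewrite expr0 mulr1 f0_ge1.
apply/andP; split.
  rewrite -[leRHS](root i)// lerXn2r ?nnegrE ?powR_ge0 ?(ltW sup_gt0)//.
  apply: ge_sup; first by case: S_sup.
  move=> s Ss; rewrite -(ler_pXn2r i0) ?nnegrE ?powR_ge0 ?root ?S_ub//.
  by case: Ss.
rewrite -ler_pdivrMl// mulrC -/(g i) -(root i (g i))//.
rewrite lerXn2r ?nnegrE ?powR_ge0 ?(ltW sup_gt0)//; apply: supP.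
split; first exact: powR_ge0.
by exists i; rewrite ?root.
Qed.

(** * The strip of forbidden differences *)

Lemma card_le_ord n (P : pred 'I_n) c d :
  (forall x, P x -> c <= x < c + d)%N -> (#|[set x | P x]| <= d)%N.
Proof.
move=> H; rewrite cardE -(size_map val) -(size_iota c d); apply: uniq_leq_size.
  by rewrite map_inj_uniq ?enum_uniq//; exact: val_inj.
by move=> i /mapP[x]; rewrite mem_enum inE => /H ? ->; rewrite mem_iota.
Qed.

Lemma missingP n k (a : seq nat) (A : {set 'I_n}) :
  reflect (forall (x y : 'I_n) s, x \in A -> y \in A -> s \in a ->
             (x + y)%N <> (k + s)%N)
          (A \in missing n k a).
Proof.
rewrite inE; apply: (iffP allP) => [H x y s xA yA sa xys|H s sa].
  have /negP := H _ sa; apply; apply/exists_inP; exists x => //.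
  by apply/exists_inP; exists y => //; rewrite xys.
apply/negP => /exists_inP[x xA /exists_inP[y yA /eqP e]].
exact: H xA yA sa (esym e).
Qed.

Section Strip.
Set Implicit Arguments.
Unset Strict Implicit.
Variable a : seq nat.

(** The independent sets of the strip of length L: [inl x] stands for the
    integer x and [inr y] for the mirror image k - y of y, so the pair is
    forbidden when x + (k - y) = k + s with s in a. *)
Definition strip (L : nat) : {set {set 'I_L + 'I_L}} :=
  [set A : {set 'I_L + 'I_L} | [forall x : 'I_L, forall y : 'I_L,
     (inl x \in A) && (inr y \in A) ==> ~~ has (fun s => x == y + s :> nat)%N a]].

Lemma stripP L (A : {set 'I_L + 'I_L}) :
  reflect (forall x y s, inl x \in A -> inr y \in A -> s \in a ->
             (x : nat) <> (y + s)%N)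
          (A \in strip L).
Proof.
rewrite inE; apply: (iffP forallP) => [H x y s xA yA sa xys|H x].
  have /forallP/(_ y)/implyP := H x; rewrite xA yA => /(_ isT)/hasP; apply.
  by exists s => //; apply/eqP.
apply/forallP => y; apply/implyP => /andP[xA yA]; apply/hasP => -[s sa /eqP].
exact: H.
Qed.

Variables (R : realType) (D : nat).
Hypothesis aD : forall s, s \in a -> (s <= D)%N.

Definition strip_cat L M (z : ('I_L + 'I_L) + ('I_M + 'I_M)) :
    'I_(L + M) + 'I_(L + M) :=
  match z with
  | inl (inl x) => inl (lshift M x)
  | inl (inr y) => inr (lshift M y)
  | inr (inl x) => inl (rshift L x)
  | inr (inr y) => inr (rshift L y)
  end.

Lemma strip_cat_inj L M : injective (@strip_cat L M).
Proof.
move=> [[]x|[]x] [[]y|[]y] // [] e; have xL := ltn_ord x; have yL := ltn_ord y;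
  by [lia | do 2 congr (_ _); apply: val_inj => /=; lia].
Qed.

Lemma strip_submul L M :
  uniform_prob R (strip (L + M)) <= uniform_prob R (strip L) * uniform_prob R (strip M).
Proof.
rewrite -uniform_prob_sum_event.
apply: uniform_prob_le_preimset (@strip_cat_inj L M) _ => A /stripP HA.
rewrite inE; apply/andP.
split; apply/stripP => x y s; rewrite !inE => xA yA sa e.
  exact: HA xA yA sa e.
by apply: HA xA yA sa _ => /=; lia.
Qed.

(** The pairs that cross the cut at height L join some [inl x], x >= L, to some
    [inr y] with L - D <= y < L, so emptying D vertices separates the two
    pieces. *)
Lemma strip_supermul L M :
  uniform_prob R (strip L) * uniform_prob R (strip M)
    <= 2 ^+ D * uniform_prob R (strip (L + M)).
Proof.
pose Y := [set y : 'I_(L + M) | (L - D <= y < L)%N].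
pose Z : {set 'I_(L + M) + 'I_(L + M)} := [set inr y | y in Y].
have cardZ : (#|Z| <= D)%N.
  rewrite card_imset; last by move=> ? ? [].
  by apply: (@card_le_ord _ _ (L - D)%N) => x; lia.
rewrite -uniform_prob_sum_event.
apply: uniform_prob_preimset_erase (@strip_cat_inj L M) cardZ _ => A.
rewrite inE => /andP[/stripP HL /stripP HM].
apply/stripP => x y s; rewrite !inE => /andP[_ xA] /andP[yZ yA] sa e.
have sD := aD sa.
have {yZ} : ~~ (L - D <= y < L)%N.
  by apply: contra yZ => yY; apply/imsetP; exists y => //; rewrite inE.
case: (split_ordP x) (split_ordP y) xA yA e => x' -> [] y' -> /= xA yA e.
- by move=> _; apply: (HL x' y' s); rewrite ?inE.
- by have := ltn_ord x'; lia.
- by lia.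
- by move=> _; apply: (HM x' y' s); rewrite ?inE//; lia.
Qed.

(** * Folding the integers about k / 2 *)

Lemma ltn_half_trans n k (kn : (k < n)%N) (x : 'I_k./2) : (x < n)%N.
Proof. by have := ltn_ord x; lia. Qed.

Definition fold_half n k (kn : (k < n)%N) (z : 'I_k./2 + 'I_k./2) : 'I_n :=
  match z with
  | inl x => Ordinal (ltn_half_trans kn x)
  | inr y => Ordinal (leq_ltn_trans (leq_subr y k) kn)
  end.

Lemma fold_half_inj n k (kn : (k < n)%N) : injective (fold_half kn).
Proof.
move=> [x|x] [y|y] [] e; have xL := ltn_ord x; have yL := ltn_ord y;
  by [lia | congr (_ _); apply: val_inj => /=; lia].
Qed.

Lemma missing_le_strip n k (kn : (k < n)%N) :
  uniform_prob R (missing n k a) <= uniform_prob R (strip k./2).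
Proof.
apply: uniform_prob_le_preimset (fold_half_inj (kn := kn)) _ => A /missingP HA.
apply/stripP => x y s; rewrite !inE => xA yA sa e.
by apply: HA xA yA sa _ => /=; have := ltn_ord y; lia.
Qed.

(** Take x <= y with x + y = k + s.  Unless x is in the window of length D + 1
    above k / 2, it lies below k / 2; unless y is in [k + 1, k + D], we get
    y = k - (x - s) with x - s a height of the strip.  So emptying these two
    windows leaves only the pairs that the strip forbids. *)
Lemma strip_le_missing n k : (k < n)%N ->
  uniform_prob R (strip k./2)
    <= 2 ^+ (D + D.+1) * uniform_prob R (missing n k a).
Proof.
move=> kn.
pose Z1 := [set x : 'I_n | (k.+1 <= x < k.+1 + D)%N].
pose Z2 := [set x : 'I_n | (k./2 <= x < k./2 + D.+1)%N].
have cardZ : (#|Z1 :|: Z2| <= D + D.+1)%N.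
  apply: leq_trans (leq_card_setU _ _) _.
  by apply: leq_add; [apply: (@card_le_ord _ _ k.+1) | apply: (@card_le_ord _ _ k./2)].
apply: uniform_prob_preimset_erase (fold_half_inj (kn := kn)) cardZ _ => A /stripP HA.
apply/missingP => x y s.
wlog le_xy : x y / (x <= y)%N.
  move=> W; have [/W//|/ltnW/W W'] := leqP x y.
  by move=> xA yA sa; rewrite addnC; apply: W'.
rewrite !inE !negb_or => /andP[/andP[xZ1 xZ2] xA] /andP[/andP[yZ1 yZ2] yA] sa e.
have sD := aD sa.
have xL : (x < k./2)%N by lia.
have yL : (x - s < k./2)%N by lia.
apply: (HA (Ordinal xL) (Ordinal yL) s) => //=; last by lia.
- by rewrite inE; congr (_ \in A): xA; apply: val_inj.
- by rewrite inE; congr (_ \in A): yA; apply: val_inj => /=; lia.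
Qed.

Lemma strip_gt0 L : 0 < uniform_prob R (strip L).
Proof. by apply: (@uniform_prob_gt0 _ _ _ set0); apply/stripP => x y s; rewrite inE. Qed.

End Strip.

(** * The decay rate *)

Lemma sorted_ltn_le_last (s : seq nat) i :
  sorted ltn s -> i \in s -> (i <= last 0 s)%N.
Proof.
rewrite (sorted_pairwise ltn_trans); case/lastP: s => // s x.
rewrite pairwise_rcons last_rcons mem_rcons inE => /andP[/allP s_lt _].
by case/predU1P => [->//|/s_lt/ltnW].
Qed.

Theorem theorem1p6 (R : realType) (m : nat) (m_ge1 : (1 <= m)%N)
    (a : m.-tuple nat) (a_incr : sorted ltn a) :
  exists lambda C1 C2 : R,
    [/\ 0 < C1, 0 < C2 &
      forall k n : nat, (k + last 0%N a < n)%N ->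
        C1 * lambda ^+ k <= uniform_prob R (missing n k a)
                         <= C2 * lambda ^+ k].
Proof.
set D := last 0%N a.
have aD s : s \in tval a -> (s <= D)%N by exact: sorted_ltn_le_last.
have [mu mu_gt0 f_mu] := quasi_multiplicative_geometric (strip_gt0 a R)
  (strip_submul a R) (strip_supermul R aD).
pose lambda := Num.sqrt mu.
have l_gt0 : 0 < lambda by rewrite sqrtr_gt0.
have mu_half k : mu ^+ k./2 = lambda ^+ (k./2).*2.
  by rewrite -mul2n exprM sqr_sqrtr// ltW.
(* mu ^ k./2 is lambda ^ k for even k and lambda ^ (k - 1) for odd k; the
   factors 1 + lambda and 1 + lambda^-1 cover both parities. *)
have le_half k : lambda ^+ k <= (1 + lambda) * mu ^+ k./2.
  rewrite mu_half -{1}(odd_double_half k) exprD ler_pM2r ?exprn_gt0//.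
  by case: (odd k); rewrite ?expr1 ?expr0 ?lerDl ?lerDr// ltW.
have half_le k : mu ^+ k./2 <= (1 + lambda^-1) * lambda ^+ k.
  rewrite mu_half -{2}(odd_double_half k) exprD mulrA.
  rewrite ler_peMl ?exprn_ge0 ?(ltW l_gt0)//.
  case: (odd k); last by rewrite mulr1 lerDl invr_ge0 ltW.
  by rewrite expr1 mulrDl mulVf ?gt_eqF// lerDr mul1r ltW.
exists lambda, (2 ^- (D + D.+1) / (1 + lambda)), (2 ^+ D * (1 + lambda^-1)).
have l1_gt0 : 0 < 1 + lambda by rewrite addr_gt0.
split.
- by rewrite divr_gt0// invr_gt0 exprn_gt0.
- by rewrite mulr_gt0 ?exprn_gt0// addr_gt0 ?invr_gt0.
move=> k n kn; have k_lt_n : (k < n)%N by lia.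
have /andP[f_ge f_le] := f_mu k./2.
apply/andP; split.
  rewrite -mulrA ler_pdivrMl ?exprn_gt0// ler_pdivrMl//.
  apply: le_trans (le_half k) _; rewrite ler_pM2l//.
  exact: le_trans f_ge (strip_le_missing R aD k_lt_n).
apply: le_trans (missing_le_strip a R k_lt_n) _; apply: le_trans f_le _.
by rewrite -mulrA ler_pM2l ?exprn_gt0.
Qed.
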